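(* Let $k \ge 1$ and $\theta = 2\pi/(4k+5)$, and write $s = \sec(\theta/2)$. For every $\varepsilon > 0$ there exist a finite point set $P$ in general position and $u, w \in P$ such that the shortest path between $u$ and $w$ in the $\theta_{4k+5}$-graph on $P$ has length at least $(L - \varepsilon)|uw|$, where $$L = \tfrac12\sqrt{4s + 7s^2 + 4s^3 + s^4 - 8\cos(\theta/2) - 4} + \tan(\theta/2) + \tfrac12 s\tan(\theta/2).$$ That is, the worst-case spanning ratio of $\theta_{4k+5}$-graphs is at least $L$.
   Context: Cones: for $m \ge 2$, $\theta = 2\pi/m$; around each point $u$ draw $m$ rays with consecutive angular separation $\theta$, oriented so the vertical upward ray from $u$ bisects a cone $C_0^u$; cones numbered clockwise, same orientation at every point. General position: no two points on a line parallel to a cone boundary ray, no two on a line perpendicular to a cone bisector, no three collinear. The $\theta_m$-graph on $P$: for each $u\in P$ and each cone $C_i^u$ containing another point of $P$, add an edge from $u$ to the point of $C_i^u$ whose orthogonal projection onto the bisector of $C_i^u$ is closest to $u$; edges weighted by Euclidean length. *)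

(* Defs.v *)
From Stdlib Require Import Reals Lra List.
Open Scope R_scope.

Definition pt : Type := (R * R)%type.

Definition dot (p q : pt) : R := fst p * fst q + snd p * snd q.
Definition cross (p q : pt) : R := fst p * snd q - snd p * fst q.
Definition vsub (p q : pt) : pt := (fst p - fst q, snd p - snd q).
Definition edist (p q : pt) : R := sqrt (dot (vsub p q) (vsub p q)).

Definition cone_angle (m : nat) : R := 2 * PI / INR m.

Definition dir (a : R) : pt := (cos a, sin a).

(* Bisector of cone C_i: cone C_0 is bisected by the upward vertical ray
   (angle pi/2) and cones are numbered clockwise, so the bisector of C_i
   has angle pi/2 - i*theta. *)
Definition bisector (m i : nat) : pt := dir (PI / 2 - INR i * cone_angle m).

Definition boundary_ray (m i : nat) : pt :=
  dir (PI / 2 - INR i * cone_angle m + cone_angle m / 2).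

(* v lies in cone C_i^u: v <> u and the angle between v - u and the bisector
   of C_i is at most theta/2. (Boundary points never occur in general
   position.) *)
Definition in_cone (m i : nat) (u v : pt) : Prop :=
  v <> u /\
  dot (vsub v u) (bisector m i) >= edist v u * cos (cone_angle m / 2).

Definition proj (m i : nat) (u v : pt) : R := dot (vsub v u) (bisector m i).

Definition gen_pos (m : nat) (P : list pt) : Prop :=
  (forall u v, In u P -> In v P -> u <> v ->
     forall i, (i < m)%nat ->
       cross (vsub v u) (boundary_ray m i) <> 0 /\
       dot (vsub v u) (bisector m i) <> 0) /\
  (forall a b c, In a P -> In b P -> In c P -> a <> b -> b <> c -> a <> c ->
     cross (vsub b a) (vsub c a) <> 0).

Definition theta_edge (m : nat) (P : list pt) (u v : pt) : Prop :=
  In u P /\ In v P /\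
  exists i, (i < m)%nat /\ in_cone m i u v /\
    forall x, In x P -> in_cone m i u x -> proj m i u v <= proj m i u x.

Definition theta_adj (m : nat) (P : list pt) (u v : pt) : Prop :=
  theta_edge m P u v \/ theta_edge m P v u.

Fixpoint walk (adj : pt -> pt -> Prop) (a : pt) (l : list pt) (b : pt) : Prop :=
  match l with
  | nil => a = b
  | x :: l' => adj a x /\ walk adj x l' b
  end.

Fixpoint walk_len (a : pt) (l : list pt) : R :=
  match l with
  | nil => 0
  | x :: l' => edist a x + walk_len x l'
  end.

Definition lower_bound_L (k : nat) : R :=
  let th := cone_angle (4 * k + 5) in
  let s := / cos (th / 2) in
  / 2 * sqrt (4 * s + 7 * s ^ 2 + 4 * s ^ 3 + s ^ 4 - 8 * cos (th / 2) - 4)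
  + tan (th / 2) + / 2 * s * tan (th / 2).

(* Main.v *)
Require Import Defs.
From Stdlib Require Import Reals List.
From Stdlib Require Import Lra Lia Rgeom.
Open Scope R_scope.

(* Rotate the cones so that uw is perpendicular to the bisector of C_0; since
   m = 4k+5, it then makes the angle theta/4 with the bisector of the cone of u
   that contains w, and the picture is symmetric in the perpendicular bisector
   of uw. Put a point Inner in the far corner of T_uw, then points Upper and
   Lower in the corners of T_(w,Inner) and T_(Inner,w) outside T_uw, and reflect
   everything. These points block the edges uw, w-Inner, u-Lower,
   Lower-Lower' and their mirror images. The shortest remaining path is
   u - Upper - w, whose length |u Upper| + |Upper w| is L; this is certified by a
   potential on the eight points that is 1-Lipschitz along every pair that is
   not blocked. Blocking and the Lipschitz bound up to a factor 1 - r are open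
   conditions, so the points can be moved into general position, each one
   avoiding finitely many lines. *)

(** * Euclidean distance *)

Lemma edist_dist_euc (p q : pt) :
  edist p q = dist_euc (fst p) (snd p) (fst q) (snd q).
Proof.
  unfold edist, dist_euc, dot, vsub, Rsqr; destruct p, q; simpl; f_equal; ring.
Qed.

Lemma edist_sym (p q : pt) : edist p q = edist q p.
Proof. rewrite !edist_dist_euc; apply distance_symm. Qed.

Lemma edist_triangle (p q r : pt) : edist p r <= edist p q + edist q r.
Proof. rewrite !edist_dist_euc; apply triangle. Qed.

Lemma edist_nonneg (p q : pt) : 0 <= edist p q.
Proof. apply sqrt_pos. Qed.

Lemma edist_sq (p q : pt) :
  edist p q * edist p q = (fst p - fst q)^2 + (snd p - snd q)^2.
Proof.
  unfold edist; rewrite sqrt_sqrt; unfold dot, vsub; simpl; [ring|].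
  apply Rplus_le_le_0_compat; apply Rle_0_sqr.
Qed.

Lemma edist_pos (p q : pt) : p <> q -> 0 < edist p q.
Proof.
  intros Hne; destruct (edist_nonneg p q) as [H|H]; [exact H|exfalso].
  pose proof (edist_sq p q) as E; rewrite <- H in E.
  destruct p as [x y], q as [x' y']; simpl in E.
  pose proof (pow2_ge_0 (x - x')); pose proof (pow2_ge_0 (y - y')).
  apply Hne; f_equal; apply Rminus_diag_uniq, Rsqr_0_uniq; unfold Rsqr; lra.
Qed.

Lemma edist_eq (p q : pt) (r : R) :
  0 <= r -> (fst p - fst q)^2 + (snd p - snd q)^2 = r^2 -> edist p q = r.
Proof.
  intros Hr E; pose proof (edist_sq p q); pose proof (edist_nonneg p q).
  apply Rsqr_inj; unfold Rsqr; lra.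
Qed.

Lemma edist_ge_fst (p q : pt) : fst p - fst q <= edist p q.
Proof.
  pose proof (edist_sq p q); pose proof (edist_nonneg p q).
  pose proof (pow2_ge_0 (snd p - snd q)).
  apply Rsqr_incr_0_var; unfold Rsqr; lra.
Qed.

(** * Cones *)

Lemma dot_dir (r g b : R) : dot (r * cos g, r * sin g) (dir b) = r * cos (g - b).
Proof. unfold dot, dir; simpl; rewrite cos_minus; ring. Qed.

Lemma cos_lt_away (c x : R) : 0 < c < PI -> c < x < 2 * PI - c -> cos x < cos c.
Proof.
  intros Hc Hx; destruct (Rle_dec x PI).
  - apply cos_decreasing_1; lra.
  - replace (cos x) with (cos (2 * PI - x)).
    + apply cos_decreasing_1; lra.
    + rewrite cos_minus, cos_2PI, sin_2PI; ring.
Qed.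

(** With [p] and [q] the components of [v] along and across [dir b], [p^2 + q^2 = r^2], so
    [acos (p / r)] is the angle up to sign. This turns cone membership into a statement about
    angles. *)
Lemma polar_exists (v : pt) (b c : R) :
  0 < c < PI -> 0 < dot v v -> sqrt (dot v v) * cos c < dot v (dir b) ->
  exists g, -c < g < c /\
    v = (sqrt (dot v v) * cos (b + g), sqrt (dot v v) * sin (b + g)).
Proof.
  intros Hc Hv Hd.
  set (r := sqrt (dot v v)) in *.
  assert (Hr : 0 < r) by (apply sqrt_lt_R0; exact Hv).
  assert (Hrr : r * r = dot v v) by (apply sqrt_sqrt; lra).
  set (p := dot v (dir b)) in *.
  set (q := cross (dir b) v).
  pose proof (sin2_cos2 b) as Hb; unfold Rsqr in Hb.
  assert (Hpq : p * p + q * q = r * r).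
  { rewrite Hrr; unfold p, q, dot, cross, dir; simpl.
    transitivity ((fst v * fst v + snd v * snd v) * (sin b * sin b + cos b * cos b));
      [ring|rewrite Hb; ring]. }
  assert (Hx : fst v = p * cos b - q * sin b).
  { unfold p, q, dot, cross, dir; simpl.
    transitivity (fst v * (sin b * sin b + cos b * cos b)); [rewrite Hb|]; ring. }
  assert (Hy : snd v = p * sin b + q * cos b).
  { unfold p, q, dot, cross, dir; simpl.
    transitivity (snd v * (sin b * sin b + cos b * cos b)); [rewrite Hb|]; ring. }
  assert (Hp1 : -1 <= p / r <= 1).
  { split; [apply Rmult_le_reg_r with r|apply Rmult_le_reg_r with r];
    try lra; unfold Rdiv; rewrite Rmult_assoc, Rinv_l by lra; nra. }
  set (a := acos (p / r)).
  assert (Hca : r * cos a = p) by (unfold a; rewrite cos_acos by lra; field; lra).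
  pose proof (acos_bound (p / r)) as Hab; fold a in Hab.
  assert (Hac : a < c).
  { destruct (Rlt_dec a c) as [|Hn]; [assumption|exfalso].
    assert (cos a <= cos c) by (apply cos_decr_1; lra). nra. }
  pose proof (sin2_cos2 a) as Ha; unfold Rsqr in Ha.
  assert (Hsa : 0 <= sin a) by (apply sin_ge_0; lra).
  assert (Hq2 : (q - r * sin a) * (q + r * sin a) = 0).
  { transitivity (p*p + q*q - r*r*(sin a * sin a + cos a * cos a)
      + (r * cos a * (r * cos a) - p*p)); [ring|]; rewrite Ha, Hpq, Hca; ring. }
  (* The two factors correspond to the two sides of the bisector, that is, to the sign of the
     angle. *)
  destruct (Rmult_integral _ _ Hq2) as [Hq|Hq].
  - exists a; split; [lra|].
    rewrite (surjective_pairing v), cos_plus, sin_plus, Hx, Hy.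
    replace q with (r * sin a) by lra; rewrite <- Hca; f_equal; ring.
  - exists (-a); split; [lra|].
    rewrite (surjective_pairing v), cos_plus, sin_plus, cos_neg, sin_neg, Hx, Hy.
    replace q with (- (r * sin a)) by lra; rewrite <- Hca; f_equal; ring.
Qed.

(* Every condition of the construction is the strict positivity of such a quantity. *)
Definition gap (a : R) (x y : pt) : R := dot (vsub y x) (dir a).

(** The interior of the cone of half-angle [c] as an intersection of two half-planes: the two
    directions are the inward normals of the boundary rays at the angles [b - c] and [b + c]. *)
Definition open_cone (c b : R) (x y : pt) : Prop :=
  0 < gap (b - c + PI / 2) x y /\ 0 < gap (b + c - PI / 2) x y.

(** The two gaps are [p sin c + q cos c] and [p sin c - q cos c], hence [|q| cos c < p sin c].
    Squaring and adding [p^2 cos^2 c] compares [p] with the distance times [cos c]. *)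
Lemma open_cone_dot (c b : R) (x y : pt) :
  0 < c < PI / 2 -> open_cone c b x y ->
  x <> y /\ edist y x * cos c < dot (vsub y x) (dir b).
Proof.
  intros Hc [H1 H2]; unfold gap in *.
  set (v := vsub y x) in *.
  assert (Hdist : edist y x = sqrt (dot v v)) by reflexivity.
  assert (Hv0 : x = y -> fst v = 0 /\ snd v = 0)
    by (intros ->; unfold v; simpl; split; ring).
  clearbody v.
  set (p := dot v (dir b)).
  set (q := cross (dir b) v).
  pose proof (sin2_cos2 b) as Hb; unfold Rsqr in Hb.
  assert (Hpq : p * p + q * q = dot v v).
  { unfold p, q, dot, cross, dir; simpl.
    transitivity ((fst v * fst v + snd v * snd v) * (sin b * sin b + cos b * cos b));
      [ring|rewrite Hb; ring]. }
  assert (E1 : dot v (dir (b - c + PI/2)) = p * sin c + q * cos c).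
  { unfold dot, dir; simpl; rewrite cos_plus, sin_plus, cos_PI2, sin_PI2, cos_minus, sin_minus.
    unfold p, q, dot, cross, dir; simpl; ring. }
  assert (E2 : dot v (dir (b + c - PI/2)) = p * sin c - q * cos c).
  { unfold dot, dir; simpl; rewrite cos_minus, sin_minus, cos_PI2, sin_PI2, cos_plus, sin_plus.
    unfold p, q, dot, cross, dir; simpl; ring. }
  rewrite E1 in H1; rewrite E2 in H2.
  assert (Hs : 0 < sin c) by (apply sin_gt_0; lra).
  assert (Hcs : 0 < cos c) by (apply cos_gt_0; lra).
  assert (Hp : 0 < p) by nra.
  split.
  - intros E; destruct (Hv0 E) as [E3 E4]; assert (p = 0); [|lra].
    unfold p, dot; rewrite E3, E4; ring.
  - pose proof (sin2_cos2 c) as Hc1; unfold Rsqr in Hc1.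
    assert (Hq : q * cos c * (q * cos c) < p * sin c * (p * sin c)) by nra.
    rewrite Hdist.
    pose proof (sqrt_pos (dot v v)).
    assert (Hsq : sqrt (dot v v) * sqrt (dot v v) = dot v v)
      by (apply sqrt_sqrt; nra).
    apply Rnot_le_lt; intros Hle.
    assert (p * p <= sqrt (dot v v) * cos c * (sqrt (dot v v) * cos c))
      by (apply Rmult_le_compat; lra).
    assert (dot v v * (cos c * cos c) = (p*p+q*q) * (cos c * cos c)) by (rewrite Hpq; ring).
    assert (p * p * (sin c * sin c + cos c * cos c) = p * p) by (rewrite Hc1; ring).
    nra.
Qed.

Lemma cone_angle_bounds (m : nat) : (5 <= m)%nat ->
  0 < cone_angle m / 2 < PI / 2 /\ INR m * cone_angle m = 2 * PI.
Proof.
  intros Hm; unfold cone_angle; pose proof PI_RGT_0.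
  assert (5 <= INR m) by (replace 5 with (INR 5) by (simpl; ring); apply le_INR; lia).
  assert (E : INR m * (2 * PI / INR m) = 2 * PI) by (field; lra).
  split; [|exact E].
  assert (0 < 2 * PI / INR m) by (apply Rdiv_lt_0_compat; lra).
  split; [lra|nra].
Qed.

Lemma open_in_cone (m i : nat) (b : R) (x y : pt) :
  (5 <= m)%nat -> bisector m i = dir b ->
  open_cone (cone_angle m / 2) b x y -> in_cone m i x y.
Proof.
  intros Hm Hb Ho; destruct (cone_angle_bounds m Hm) as [Hc _].
  destruct (open_cone_dot _ _ _ _ Hc Ho) as [Hne Hd].
  split; [congruence|rewrite Hb; lra].
Qed.

(** A direction at angle [g] from bisector [i], with [|g| < c], is at angle [2 n c + g] or
    [2 n c - g] from another bisector, where [1 <= n <= m - 1]. Since [2 m c = 2 PI], this lies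
    strictly between [c] and [2 PI - c], so even the closed cone [j] is excluded. *)
Lemma open_cone_unique (m i j : nat) (b : R) (x y : pt) :
  (5 <= m)%nat -> (i < m)%nat -> (j < m)%nat -> bisector m i = dir b ->
  open_cone (cone_angle m / 2) b x y -> in_cone m j x y -> j = i.
Proof.
  intros Hm Hi Hj Hb Ho [_ Hin].
  destruct (cone_angle_bounds m Hm) as [Hc Hmc].
  destruct (open_cone_dot _ _ _ _ Hc Ho) as [Hne Hd].
  set (c := cone_angle m / 2) in *.
  assert (Hth : cone_angle m = 2 * c) by (unfold c; lra).
  rewrite <- Hb in Hd; unfold bisector in Hd, Hin; rewrite Hth in *.
  set (b0 := PI / 2 - INR i * (2 * c)) in *.
  assert (Hvv : 0 < dot (vsub y x) (vsub y x)).
  { pose proof (edist_pos y x (not_eq_sym Hne)) as Hp; unfold edist in Hp.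
    apply Rnot_le_lt; intros Hle; rewrite sqrt_neg_0 in Hp; lra. }
  destruct (polar_exists (vsub y x) b0 c ltac:(lra) Hvv Hd) as [g [Hg Hv]].
  change (sqrt (dot (vsub y x) (vsub y x))) with (edist y x) in Hv.
  rewrite Hv, dot_dir in Hin.
  pose proof (edist_pos y x (not_eq_sym Hne)) as Hr.
  assert (Hcos : cos c <= cos (b0 + g - (PI / 2 - INR j * (2 * c)))) by nra.
  pose proof (le_INR _ _ Hi) as Hi'; rewrite S_INR in Hi'.
  pose proof (le_INR _ _ Hj) as Hj'; rewrite S_INR in Hj'.
  pose proof (pos_INR i); pose proof (pos_INR j).
  destruct (Nat.lt_trichotomy j i) as [Hlt|[->|Hlt]]; [exfalso|reflexivity|exfalso].
  - assert (1 <= INR i - INR j <= INR m - 1).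
    { pose proof (le_INR _ _ Hlt) as Hl; rewrite S_INR in Hl; lra. }
    replace (b0 + g - (PI / 2 - INR j * (2 * c)))
      with (- ((INR i - INR j) * (2 * c) - g)) in Hcos by (unfold b0; ring).
    rewrite cos_neg in Hcos.
    assert (cos ((INR i - INR j) * (2 * c) - g) < cos c)
      by (apply cos_lt_away; nra).
    lra.
  - assert (1 <= INR j - INR i <= INR m - 1).
    { pose proof (le_INR _ _ Hlt) as Hl; rewrite S_INR in Hl; lra. }
    replace (b0 + g - (PI / 2 - INR j * (2 * c)))
      with ((INR j - INR i) * (2 * c) + g) in Hcos by (unfold b0; ring).
    assert (cos ((INR j - INR i) * (2 * c) + g) < cos c)
      by (apply cos_lt_away; nra).
    lra.
Qed.

Definition blocks (c b : R) (x y z : pt) : Prop :=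
  open_cone c b x y /\ open_cone c b x z /\ 0 < gap b z y.

(** The point [z] beats [y] in one cone of [x]; as [y] lies in no other cone of [x], no cone of [x]
    can yield the edge. *)
Lemma blocks_no_edge (m i : nat) (b : R) (P : list pt) (x y z : pt) :
  (5 <= m)%nat -> (i < m)%nat -> bisector m i = dir b -> In z P ->
  blocks (cone_angle m / 2) b x y z -> ~ theta_edge m P x y.
Proof.
  intros Hm Hi Hb Hz [Hy [Hxz Hgap]] [_ [_ [j [Hj [Hin Hmin]]]]].
  assert (j = i) by (now apply (open_cone_unique m i j b x y)); subst j.
  pose proof (Hmin z Hz (open_in_cone _ _ _ _ _ Hm Hb Hxz)) as Hle.
  unfold proj in Hle; rewrite Hb in Hle.
  unfold gap, dot, vsub in *; simpl in *; lra.
Qed.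

(** * General position *)

Definition near (d : R) (p q : pt) : Prop :=
  Rabs (fst p - fst q) < d /\ Rabs (snd p - snd q) < d.

Lemma near_trans (d d' : R) (p q r : pt) :
  near d p q -> near d' q r -> near (d + d') p r.
Proof.
  intros [H1 H2] [H3 H4]; split.
  - replace (fst p - fst r) with ((fst p - fst q) + (fst q - fst r)) by ring.
    eapply Rle_lt_trans; [apply Rabs_triang|lra].
  - replace (snd p - snd r) with ((snd p - snd q) + (snd q - snd r)) by ring.
    eapply Rle_lt_trans; [apply Rabs_triang|lra].
Qed.

Lemma near_le (d d' : R) (p q : pt) : d <= d' -> near d p q -> near d' p q.
Proof. intros H [H1 H2]; split; lra. Qed.

Lemma near_refl (d : R) (p : pt) : 0 < d -> near d p p.
Proof. intros Hd; split; rewrite Rminus_diag, Rabs_R0; exact Hd. Qed.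

(** Says that [S] has dense interior. Asking for a whole smaller ball, not just for a point, makes
    the property stable under intersection. *)
Definition open_dense (S : pt -> Prop) : Prop :=
  forall p d, 0 < d -> exists p' d', 0 < d' /\ near d p p' /\
    forall x, near d' p' x -> near d p x /\ S x.

Lemma open_dense_impl (S S' : pt -> Prop) :
  (forall x, S x -> S' x) -> open_dense S -> open_dense S'.
Proof.
  intros H HS p d Hd; destruct (HS p d Hd) as [p' [d' [H1 [H2 H3]]]].
  exists p', d'; repeat split; try assumption; try apply H2;
  try (apply H; now apply H3); now apply H3.
Qed.

(* Open dense conditions on a point, conditions valid for small parameters, and
   conditions valid in a neighbourhood of a configuration are all combined
   through these closure properties. *)
Record filter_like {X : Type} (F : (X -> Prop) -> Prop) : Prop := {
  filter_like_true : F (fun _ => True);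
  filter_like_and : forall S S', F S -> F S' -> F (fun x => S x /\ S' x);
  filter_like_impl : forall S S' : X -> Prop, (forall x, S x -> S' x) -> F S -> F S' }.

Lemma filter_like_list {X A : Type} (F : (X -> Prop) -> Prop) (l : list A)
    (S : A -> X -> Prop) :
  filter_like F -> (forall a, In a l -> F (S a)) ->
  F (fun x => forall a, In a l -> S a x).
Proof.
  intros HF; induction l as [|a l IH]; intros H.
  - apply (filter_like_impl _ HF) with (2 := filter_like_true _ HF); intros x _ a [].
  - apply (filter_like_impl _ HF) with (fun x => S a x /\ forall a', In a' l -> S a' x).
    + intros x [H1 H2] a' [<-|Ha]; auto.
    + apply (filter_like_and _ HF); [apply H; now left|apply IH; intros; apply H; now right].
Qed.

Lemma open_dense_filter : filter_like open_dense.
Proof.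
  split.
  - intros p d Hd; exists p, d; split; [exact Hd|split; [now apply near_refl|auto]].
  - intros S S' HS HS' p d Hd; destruct (HS p d Hd) as [p1 [d1 [H1 [H2 H3]]]].
    destruct (HS' p1 d1 H1) as [p2 [d2 [H4 [H5 H6]]]].
    exists p2, d2; split; [exact H4|split; [now apply H3|]].
    intros x Hx; destruct (H6 x Hx) as [Hx1 Hx2]; destruct (H3 x Hx1); auto.
  - exact open_dense_impl.
Qed.

Lemma open_dense_lt (m : nat) (S : nat -> pt -> Prop) :
  (forall i, (i < m)%nat -> open_dense (S i)) ->
  open_dense (fun x => forall i, (i < m)%nat -> S i x).
Proof.
  intros H; apply open_dense_impl with (fun x => forall i, In i (seq 0 m) -> S i x).
  - intros x Hx i Hi; apply Hx, in_seq; lia.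
  - apply (filter_like_list _ _ _ open_dense_filter); intros i Hi; apply in_seq in Hi; apply H; lia.
Qed.

Lemma open_dense_line (A B C : R) :
  A <> 0 \/ B <> 0 -> open_dense (fun x => A * fst x + B * snd x + C <> 0).
Proof.
  intros HAB [x y] d Hd.
  assert (Hp : exists p', near (d / 2) (x, y) p' /\ A * fst p' + B * snd p' + C <> 0).
  { assert (Hq : Rabs (d / 4) = d / 4) by (apply Rabs_right; lra).
    destruct (Req_dec (A * x + B * y + C) 0) as [E|E].
    - destruct HAB as [HA|HB].
      + exists (x + d / 4, y); split.
        * split; simpl; [replace (x - (x + d/4)) with (-(d/4)) by ring;
            rewrite Rabs_Ropp; lra | rewrite Rminus_diag, Rabs_R0; lra].
        * simpl; replace (A * (x + d/4) + B * y + C) with (A * (d/4) + (A*x+B*y+C)) by ring.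
          rewrite E, Rplus_0_r; apply Rmult_integral_contrapositive; lra.
      + exists (x, y + d / 4); split.
        * split; simpl; [rewrite Rminus_diag, Rabs_R0; lra|
            replace (y - (y + d/4)) with (-(d/4)) by ring;
            rewrite Rabs_Ropp; lra].
        * simpl; replace (A * x + B * (y + d/4) + C) with (B * (d/4) + (A*x+B*y+C)) by ring.
          rewrite E, Rplus_0_r; apply Rmult_integral_contrapositive; lra.
    - exists (x, y); split; [apply near_refl; lra|exact E]. }
  destruct Hp as [[x' y'] [Hn Hv]]; simpl in Hv.
  set (V := A * x' + B * y' + C) in *.
  assert (HV : 0 < Rabs V) by now apply Rabs_pos_lt.
  pose proof (Rabs_pos A) as HA0; pose proof (Rabs_pos B) as HB0.
  (* [K] bounds the change of the affine form per unit of coordinate distance, so the form keeps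
     away from 0 within distance [Rabs V / K]. *)
  set (K := Rabs A + Rabs B + 1).
  assert (HK : 0 < K) by (unfold K; lra).
  assert (HVK : 0 < Rabs V / K) by now apply Rdiv_lt_0_compat.
  exists (x', y'), (Rmin (d / 2) (Rabs V / K)).
  split; [apply Rmin_glb_lt; lra|].
  split; [now apply near_le with (d / 2); [lra|]|].
  intros z Hz; split.
  - replace d with (d / 2 + d / 2) by field.
    eapply near_trans; [exact Hn|eapply near_le; [apply Rmin_l|exact Hz]].
  - apply near_le with (d' := Rabs V / K) in Hz; [|apply Rmin_r].
    destruct Hz as [H1 H2]; simpl in H1, H2; intros E.
    assert (HE : V = A * (x' - fst z) + B * (y' - snd z)) by (unfold V; lra).
    assert (Rabs V <= Rabs A * Rabs (x' - fst z) + Rabs B * Rabs (y' - snd z)).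
    { rewrite <- !Rabs_mult, HE; apply Rabs_triang. }
    assert (HVV : Rabs V = Rabs V / K * K) by (field; lra).
    unfold K in HVV at 2. nra.
Qed.

Lemma dir_nonzero (a : R) : cos a <> 0 \/ sin a <> 0.
Proof.
  destruct (Req_dec (cos a) 0) as [E|E]; [right|now left].
  pose proof (sin2_cos2 a) as H; unfold Rsqr in H; rewrite E in H; nra.
Qed.

Lemma gen_pos_cons (m : nat) (p : pt) (Q : list pt) :
  gen_pos m Q -> ~ In p Q ->
  (forall v i, In v Q -> (i < m)%nat ->
     cross (vsub v p) (boundary_ray m i) <> 0 /\
     dot (vsub v p) (bisector m i) <> 0) ->
  (forall b c, In b Q -> In c Q -> b <> c -> cross (vsub b p) (vsub c p) <> 0) ->
  gen_pos m (p :: Q).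
Proof.
  intros [H1 H2] Hp Hpair Htri; split.
  - intros u v [<-|Hu] [<-|Hv] Hne i Hi.
    + congruence.
    + now apply Hpair.
    + destruct (Hpair u i Hu Hi) as [Ha Hb]; split; intros E.
      * apply Ha; rewrite <- Ropp_0, <- E; unfold cross, vsub; simpl; ring.
      * apply Hb; rewrite <- Ropp_0, <- E; unfold dot, vsub; simpl; ring.
    + now apply H1.
  - intros a b c Ha Hb Hc Hab Hbc Hac E.
    destruct Ha as [<-|Ha]; [destruct Hb as [<-|Hb];
      [congruence|destruct Hc as [<-|Hc]; [congruence|now apply (Htri b c)]]|].
    destruct Hb as [<-|Hb]; [destruct Hc as [<-|Hc]; [congruence|]|].
    + apply (Htri a c Ha Hc Hac); rewrite <- Ropp_0, <- E; unfold cross, vsub; simpl; ring.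
    + destruct Hc as [<-|Hc]; [|now apply (H2 a b c)].
      apply (Htri a b Ha Hb Hab); rewrite <- E; unfold cross, vsub; simpl; ring.
Qed.

(** Each condition keeps the new point off a line: a line through an old point, parallel to a
    boundary ray or perpendicular to a bisector, or the line through two old points. *)
Lemma gen_pos_extend (m : nat) (Q : list pt) :
  open_dense (fun p => ~ In p Q /\
    (forall v, In v Q -> forall i, (i < m)%nat ->
     cross (vsub v p) (boundary_ray m i) <> 0 /\
     dot (vsub v p) (bisector m i) <> 0) /\
    (forall b, In b Q -> forall c, In c Q -> b <> c -> cross (vsub b p) (vsub c p) <> 0)).
Proof.
  apply (filter_like_and _ open_dense_filter); [|apply (filter_like_and _ open_dense_filter)].
  (* Being distinct from [v] is strengthened to avoiding the vertical line through [v], which makes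
     it a linear condition. *)
  - apply open_dense_impl with (fun p => forall v, In v Q -> 1 * fst p + 0 * snd p + - fst v <> 0).
    + intros p H Hin; apply (H p Hin); ring.
    + apply (filter_like_list _ _ _ open_dense_filter); intros v _; apply open_dense_line; left; lra.
  - apply (filter_like_list _ _ _ open_dense_filter); intros v _; apply open_dense_lt; intros i _.
    apply (filter_like_and _ open_dense_filter).
    + unfold boundary_ray; set (a := PI / 2 - INR i * cone_angle m + cone_angle m / 2).
      apply open_dense_impl with (fun p => - sin a * fst p + cos a * snd p
        + (fst v * sin a - snd v * cos a) <> 0).
      * intros p H E; apply H; rewrite <- E; unfold cross, vsub, dir; simpl; ring.
      * apply open_dense_line; destruct (dir_nonzero a); [now right|left; lra].
    + unfold bisector; set (a := PI / 2 - INR i * cone_angle m).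
      apply open_dense_impl with (fun p => - cos a * fst p + - sin a * snd p
        + (fst v * cos a + snd v * sin a) <> 0).
      * intros p H E; apply H; rewrite <- E; unfold dot, vsub, dir; simpl; ring.
      * apply open_dense_line; destruct (dir_nonzero a); [left|right]; lra.
  - apply (filter_like_list _ _ _ open_dense_filter); intros b _; apply (filter_like_list _ _ _ open_dense_filter); intros c _.
    destruct (Req_dec (fst b) (fst c)) as [E1|E1];
    [destruct (Req_dec (snd b) (snd c)) as [E2|E2]|].
    + apply open_dense_impl with (2 := filter_like_true _ open_dense_filter); intros p _ Hne.
      exfalso; apply Hne; destruct b, c; simpl in *; congruence.
    + apply open_dense_impl with (fun p => (snd b - snd c) * fst p + (fst c - fst b) * snd p
        + cross b c <> 0).
      * intros p H _ E; apply H; rewrite <- E; unfold cross, vsub; simpl; ring.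
      * apply open_dense_line; left; lra.
    + apply open_dense_impl with (fun p => (snd b - snd c) * fst p + (fst c - fst b) * snd p
        + cross b c <> 0).
      * intros p H _ E; apply H; rewrite <- E; unfold cross, vsub; simpl; ring.
      * apply open_dense_line; right; lra.
Qed.

(** The points are placed one at a time, each in general position with respect to those already
    placed. *)
Lemma gen_pos_perturb (A : Type) (A_dec : forall a b : A, {a = b} + {a <> b})
    (m : nat) (l : list A) (T : A -> pt) (d : R) :
  0 < d -> NoDup l ->
  exists P : A -> pt, (forall a, near d (T a) (P a)) /\
    NoDup (map P l) /\ gen_pos m (map P l).
Proof.
  intros Hd; induction l as [|a l IH]; intros Hl.
  - exists T; split; [intros; now apply near_refl|split; [constructor|]].
    split; [intros u v []|intros u v w []].
  - inversion Hl as [|? ? Ha Hl']; subst.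
    destruct (IH Hl') as [P [H1 [H2 H3]]].
    destruct (gen_pos_extend m (map P l) (T a) d Hd) as [p [d' [Hd' [Hp Hx]]]].
    destruct (Hx p (near_refl _ _ Hd')) as [_ [Hp1 [Hp2 Hp3]]].
    set (P' := fun x => if A_dec x a then p else P x).
    assert (EP : map P' (a :: l) = p :: map P l).
    { simpl; unfold P' at 1; destruct (A_dec a a); [|congruence].
      f_equal; apply map_ext_in; intros x Hxl; unfold P'.
      destruct (A_dec x a); [congruence|reflexivity]. }
    exists P'; rewrite EP; split; [|split].
    + intros x; unfold P'; destruct (A_dec x a); [now subst|apply H1].
    + now constructor.
    + apply gen_pos_cons; auto.
Qed.

(** * The eight-point configuration and its reflection symmetry *)

(* (false, k) are the points near w = (1, 0) and (true, k) their mirror images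
   near u = (0, 0), for the reflection x |-> 1 - x. Terminal is w itself, Inner
   the far corner of T_uw, Upper the corner of T_(w,Inner) and Lower the corner
   of T_(Inner,w) outside T_uw. *)
Inductive kind := Terminal | Inner | Upper | Lower.
Definition idx : Type := (bool * kind)%type.

Lemma idx_dec (i j : idx) : {i = j} + {i <> j}.
Proof. repeat decide equality. Qed.

Definition all_idx : list idx := list_prod (true :: false :: nil) (Terminal :: Inner :: Upper :: Lower :: nil).

Lemma in_all_idx (i : idx) : In i all_idx.
Proof. destruct i as [[|] [| | |]]; simpl; tauto. Qed.

Lemma nodup_all_idx : NoDup all_idx.
Proof. unfold all_idx; simpl; repeat constructor; simpl; intuition congruence. Qed.

(* With h = theta/4 and |uw| = 1: bh = |w Inner|, eh = |w Upper| = |Inner Lower|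
   and bh^2 = |w Lower| = |Inner Upper|. *)
Definition bh (h : R) : R := sin (3 * h) / cos (2 * h).
Definition eh (h : R) : R := bh h * cos h / cos (2 * h).

Definition corner (h : R) (k : kind) : pt :=
  match k with
  | Terminal => (1, 0)
  | Inner => (1 - bh h * sin h, bh h * cos h)
  | Upper => (1 + eh h * sin (2 * h), eh h * cos (2 * h))
  | Lower => (1 + bh h ^ 2 * cos (2 * h), bh h ^ 2 * sin (2 * h))
  end.

(* The exact corners satisfy the blocking conditions only with equality. Moving
   Upper and Lower by order eta, and Inner by order eta^2, makes them strict
   without spoiling one another. *)
Definition shift1 (k : kind) : pt :=
  match k with Upper => (-1, -1) | Lower => (-1, 0) | _ => (0, 0) end.

(** Inner moves towards the midpoint of uw, which is interior to the cone of u containing w and has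
    half the projection of w. *)
Definition shift2 (h : R) (k : kind) : pt :=
  match k with Inner => vsub (1 / 2, 0) (corner h Inner) | _ => (0, 0) end.

Definition mir (p : pt) : pt := (1 - fst p, snd p).

Definition base (h : R) (i : idx) : pt :=
  if fst i then mir (corner h (snd i)) else corner h (snd i).

(** The linear part of [mir], which is how the reflection acts on displacements. *)
Definition flip (s : bool) (v : pt) : pt := if s then (- fst v, snd v) else v.

Definition cfg (h eta : R) (i : idx) : pt :=
  let d1 := flip (fst i) (shift1 (snd i)) in
  let d2 := flip (fst i) (shift2 h (snd i)) in
  (fst (base h i) + eta * fst d1 + eta ^ 2 * fst d2,
   snd (base h i) + eta * snd d1 + eta ^ 2 * snd d2).

Definition swap (i : idx) : idx := (negb (fst i), snd i).

Lemma cfg_swap (h eta : R) (i : idx) : cfg h eta (swap i) = mir (cfg h eta i).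
Proof.
  destruct i as [[|] k]; unfold cfg, mir, base, swap, flip, mir; simpl; f_equal; ring.
Qed.

Lemma gap_mir (a : R) (x y : pt) : gap (PI - a) (mir x) (mir y) = gap a x y.
Proof.
  unfold gap, dot, vsub, mir, dir; simpl.
  rewrite cos_minus, sin_minus, cos_PI, sin_PI; ring.
Qed.

(** The reflection exchanges the two boundary rays of a cone, so the two normals trade places. *)
Lemma blocks_mir (c b : R) (x y z : pt) :
  blocks c b x y z -> blocks c (PI - b) (mir x) (mir y) (mir z).
Proof.
  unfold blocks, open_cone; intros [[H1 H2] [[H3 H4] H5]].
  rewrite gap_mir.
  replace (PI - b - c + PI / 2) with (PI - (b + c - PI / 2)) by field.
  replace (PI - b + c - PI / 2) with (PI - (b - c + PI / 2)) by field.
  rewrite !gap_mir; tauto.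
Qed.

(** * Small parameters *)

Definition eventually (Q : R -> Prop) : Prop :=
  exists e, 0 < e /\ forall eta, 0 < eta < e -> Q eta.

Lemma eventually_filter : filter_like eventually.
Proof.
  split.
  - exists 1; split; [lra|auto].
  - intros S S' [e [He H]] [e' [He' H']]; exists (Rmin e e').
    split; [now apply Rmin_glb_lt|].
    intros x Hx; pose proof (Rmin_l e e'); pose proof (Rmin_r e e').
    split; [apply H|apply H']; lra.
  - intros S S' HS [e [He H]]; exists e; split; auto.
Qed.

(** The lowest-order nonzero coefficient dominates; when [A = 0] and [B > 0], a factor [eta] is
    split off. *)
Lemma eventually_quad (A B C : R) :
  0 < A \/ A = 0 /\ (0 < B \/ B = 0 /\ 0 < C) ->
  eventually (fun eta => 0 < A + B * eta + C * eta ^ 2).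
Proof.
  assert (main : forall A B C, 0 < A -> eventually (fun eta => 0 < A + B * eta + C * eta ^ 2)).
  { clear; intros A B C HA.
    pose proof (Rabs_pos B); pose proof (Rabs_pos C).
    set (K := Rabs B + Rabs C + 1).
    assert (HK : 0 < K) by (unfold K; lra).
    exists (Rmin 1 (A / K)); split.
    - apply Rmin_glb_lt; [lra|now apply Rdiv_lt_0_compat].
    - intros x [Hx0 Hx]; pose proof (Rmin_l 1 (A / K)); pose proof (Rmin_r 1 (A / K)).
      assert (HxA : x < A / K) by lra.
      assert (x * K < A).
      { apply Rmult_lt_compat_r with (r := K) in HxA; [|exact HK].
        unfold Rdiv in HxA; rewrite Rmult_assoc, Rinv_l, Rmult_1_r in HxA; lra. }
      pose proof (Rle_abs (- B)) as HB; pose proof (Rle_abs (- C)) as HC.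
      rewrite Rabs_Ropp in HB, HC.
      assert (x * x <= x) by nra.
      assert (- (x * Rabs B) <= B * x) by nra.
      assert (- (x * Rabs C) <= C * x ^ 2) by nra.
      unfold K in *; nra. }
  intros [HA|[HA [HB|[HB HC]]]].
  - now apply main.
  - apply (filter_like_impl _ eventually_filter) with (fun x => 0 < B + C * x + 0 * x ^ 2
      /\ 0 < x).
    + intros x [H1 H2]; rewrite HA; nra.
    + apply (filter_like_and _ eventually_filter); [now apply main|].
      exists 1; split; [lra|tauto].
  - exists 1; split; [lra|intros x Hx; rewrite HA, HB].
    assert (0 < x ^ 2) by (apply pow_lt; lra); nra.
Qed.

(** Along [cfg] a gap is a quadratic polynomial in [eta]; its coefficients are the gap at [base],
    [g1] and [g2], and the first nonzero one is required to be positive. *)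
Definition lexpos (a h : R) (i j : idx) : Prop :=
  let g1 := dot (vsub (flip (fst j) (shift1 (snd j))) (flip (fst i) (shift1 (snd i)))) (dir a) in
  let g2 := dot (vsub (flip (fst j) (shift2 h (snd j))) (flip (fst i) (shift2 h (snd i)))) (dir a) in
  0 < gap a (base h i) (base h j) \/
  gap a (base h i) (base h j) = 0 /\ (0 < g1 \/ g1 = 0 /\ 0 < g2).

Lemma lexpos_eventually (a h : R) (i j : idx) :
  lexpos a h i j -> eventually (fun eta => 0 < gap a (cfg h eta i) (cfg h eta j)).
Proof.
  intros H; apply eventually_quad in H.
  eapply (filter_like_impl _ eventually_filter); [|exact H].
  intros eta; cbv beta; intros Hx; eapply Rlt_le_trans; [exact Hx|right].
  unfold gap, cfg, dot, vsub; simpl; ring.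
Qed.

Lemma cfg_near (h d : R) : 0 < d ->
  eventually (fun eta => forall i, In i all_idx -> near d (base h i) (cfg h eta i)).
Proof.
  intros Hd; apply (filter_like_list _ _ _ eventually_filter); intros i _.
  set (d1 := flip (fst i) (shift1 (snd i))).
  set (d2 := flip (fst i) (shift2 h (snd i))).
  assert (H : forall A B, eventually (fun eta => Rabs (A * eta + B * eta ^ 2) < d)).
  { intros A B; apply (filter_like_impl _ eventually_filter) with
      (fun eta => 0 < d + A * eta + B * eta ^ 2 /\ 0 < d + - A * eta + - B * eta ^ 2).
    - intros x [H1 H2]; apply Rabs_def1; lra.
    - apply (filter_like_and _ eventually_filter); apply eventually_quad; now left. }
  eapply (filter_like_impl _ eventually_filter);
    [|apply (filter_like_and _ eventually_filter); [apply (H (fst d1) (fst d2))|apply (H (snd d1) (snd d2))]].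
  cbv beta; intros eta [H1 H2]; unfold near, cfg; fold d1 d2; simpl.
  split; rewrite Rabs_minus_sym.
  - match goal with |- Rabs ?t < _ => replace t with (fst d1 * eta + fst d2 * eta ^ 2) by ring end; exact H1.
  - match goal with |- Rabs ?t < _ => replace t with (snd d1 * eta + snd d2 * eta ^ 2) by ring end; exact H2.
Qed.

(** * Trigonometric relations *)

(** All trigonometric values become rational functions of [S] and [C] subject to [C^2 = 1 - S^2],
    within reach of [ring], [field] and [nra]. The numerical bounds round up the values at
    [h = PI/18], the case of nine cones: about 0.174, 0.532 and 0.558. *)
Record angle_facts (h S C b e : R) : Prop := {
  af_S : 0 < S < 9 / 50; af_C : 0 < C; af_SC : C ^ 2 = 1 - S ^ 2;
  af_b : b = S * (3 - 4 * S ^ 2) / (1 - 2 * S ^ 2);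
  af_e : e = b * C / (1 - 2 * S ^ 2);
  af_s1 : sin h = S; af_c1 : cos h = C; af_bh : bh h = b; af_eh : eh h = e;
  af_s2 : sin (2 * h) = 2 * S * C; af_c2 : cos (2 * h) = 1 - 2 * S ^ 2;
  af_s3 : sin (3 * h) = S * (3 - 4 * S ^ 2); af_c3 : cos (3 * h) = C * (1 - 4 * S ^ 2);
  af_s4 : sin (4 * h) = 4 * S * C * (1 - 2 * S ^ 2);
  af_c4 : cos (4 * h) = 1 - 8 * S ^ 2 + 8 * S ^ 4;
  af_b0 : 0 < b < 54 / 100; af_e0 : b < e < 58 / 100 }.

Lemma angle_facts_exist (h : R) : 0 < h <= PI / 18 ->
  angle_facts h (sin h) (cos h) (bh h) (eh h).
Proof.
  intros Hh; pose proof PI_4; pose proof PI_RGT_0.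
  assert (HC : cos h ^ 2 = 1 - sin h ^ 2)
    by (pose proof (sin2_cos2 h) as E; unfold Rsqr in E; nra).
  assert (HC0 : 0 < cos h) by (apply cos_gt_0; lra).
  assert (HS0 : 0 < sin h) by (apply sin_gt_0; lra).
  assert (Hs2 : sin (2 * h) = 2 * sin h * cos h) by apply sin_2a.
  assert (Hc2 : cos (2 * h) = 1 - 2 * sin h ^ 2) by (rewrite cos_2a_sin; ring).
  assert (Hs3 : sin (3 * h) = sin h * (3 - 4 * sin h ^ 2)).
  { replace (3 * h) with (2 * h + h) by ring; rewrite sin_plus, Hs2, Hc2; ring [HC]. }
  assert (Hc3 : cos (3 * h) = cos h * (1 - 4 * sin h ^ 2)).
  { replace (3 * h) with (2 * h + h) by ring; rewrite cos_plus, Hs2, Hc2; ring [HC]. }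
  assert (HS1 : sin h < 9 / 50).
  (* The crude bound [sin h <= h] only selects the branch of the cubic; the sharp bound then comes
     from [sin (3 * h) <= 1/2]. *)
  { assert (sin h <= h) by (left; apply sin_lt_x; lra).
    assert (Hle : sin (3 * h) <= 1 / 2).
    { rewrite <- sin_PI6; apply sin_incr_1; lra. }
    rewrite Hs3 in Hle; nra. }
  assert (Hc2p : 1 - 2 * sin h ^ 2 > 935 / 1000) by nra.
  assert (Hb : bh h = sin h * (3 - 4 * sin h ^ 2) / (1 - 2 * sin h ^ 2))
    by (unfold bh; now rewrite Hs3, Hc2).
  assert (He : eh h = bh h * cos h / (1 - 2 * sin h ^ 2))
    by (unfold eh; now rewrite Hc2).
  assert (Hbe : bh h * (1 - 2 * sin h ^ 2) = sin h * (3 - 4 * sin h ^ 2))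
    by (rewrite Hb; field; lra).
  assert (Hee : eh h * (1 - 2 * sin h ^ 2) = bh h * cos h)
    by (rewrite He; field; lra).
  assert (Hs3le : sin h * (3 - 4 * sin h ^ 2) <= 1 / 2).
  { rewrite <- Hs3, <- sin_PI6; apply sin_incr_1; lra. }
  assert (Hs3p : 0 < sin h * (3 - 4 * sin h ^ 2)) by nra.
  assert (Hb0 : 0 < bh h < 54 / 100) by (split; nra).
  assert (HC1 : cos h <= 1) by nra.
  assert (HC2 : 1 - 2 * sin h ^ 2 < cos h) by nra.
  split; auto.
  - replace (4 * h) with (2 * (2 * h)) by ring; rewrite sin_2a, Hs2, Hc2; ring.
  - replace (4 * h) with (2 * (2 * h)) by ring; rewrite cos_2a_sin, Hs2; ring [HC].
  - split.
    + apply Rmult_lt_reg_r with (1 - 2 * sin h ^ 2); [lra|]; rewrite Hee; nra.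
    + apply Rmult_lt_reg_r with (1 - 2 * sin h ^ 2); [lra|]; rewrite Hee; nra.
Qed.

(** * Blocking near the exact corners *)

Definition lexblocks (h b : R) (x y z : idx) : Prop :=
  (lexpos (b - 2 * h + PI / 2) h x y /\ lexpos (b + 2 * h - PI / 2) h x y) /\
  (lexpos (b - 2 * h + PI / 2) h x z /\ lexpos (b + 2 * h - PI / 2) h x z) /\
  lexpos b h z y.

Lemma lexblocks_eventually (h b : R) (x y z : idx) : lexblocks h b x y z ->
  eventually (fun eta => blocks (2 * h) b (cfg h eta x) (cfg h eta y) (cfg h eta z)).
Proof.
  intros [[H1 H2] [[H3 H4] H5]].
  repeat apply (filter_like_and _ eventually_filter); now apply lexpos_eventually.
Qed.

Lemma dir_plus_PI2 (a : R) : dir (a + PI / 2) = (- sin a, cos a).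
Proof. unfold dir; rewrite cos_plus, sin_plus, cos_PI2, sin_PI2; f_equal; ring. Qed.

Lemma dir_minus_PI2 (a : R) : dir (a - PI / 2) = (sin a, - cos a).
Proof. unfold dir; rewrite cos_minus, sin_minus, cos_PI2, sin_PI2; f_equal; ring. Qed.

Lemma dir_PI_minus (a : R) : dir (PI - a) = (- cos a, sin a).
Proof. unfold dir; rewrite cos_minus, sin_minus, cos_PI, sin_PI; f_equal; ring. Qed.

Ltac unfold_lexpos F :=
  destruct F as [HS HC HSC Hb He Es1 Ec1 Eb Ee Es2 Ec2 Es3 Ec3 Es4 Ec4 Hb0 He0];
  unfold lexpos, gap, base, corner, mir, flip, shift1, shift2, corner, dot, vsub.
Ltac substitute_values :=
  cbn [fst snd];
  repeat match goal with
   | E : sin ?x = _ |- context [sin ?x] => rewrite E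
   | E : cos ?x = _ |- context [cos ?x] => rewrite E
   | E : bh ?x = _ |- context [bh ?x] => rewrite E
   | E : eh ?x = _ |- context [eh ?x] => rewrite E
  end.
Ltac positive_as V := match goal with |- 0 < ?t => replace t with V; [solve [nra | repeat apply Rmult_lt_0_compat; nra]|] end.

Lemma cone_normals_right (h : R) :
  dir (h - 2 * h + PI / 2) = (sin h, cos h) /\
  dir (h + 2 * h - PI / 2) = (sin (3 * h), - cos (3 * h)).
Proof.
  split.
  - rewrite dir_plus_PI2; replace (h - 2 * h) with (- h) by ring.
    rewrite sin_neg, cos_neg; f_equal; ring.
  - rewrite dir_minus_PI2; now replace (h + 2 * h) with (3 * h) by ring.
Qed.

(** Seen from u, Inner starts on the boundary ray of angle [3 * h] and level with w. Both equalities
    persist at order [eta] and are broken at order [eta^2] by moving Inner towards the midpoint. *)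
Lemma far_terminal_avoids_terminal (h S C b e : R) (F : angle_facts h S C b e) :
  lexblocks h h (true, Terminal) (false, Terminal) (false, Inner).
Proof.
  destruct (cone_normals_right h) as [D1 D2].
  unfold lexblocks; unfold_lexpos F; rewrite D1, D2; unfold dir; substitute_values.
  split; [split; left; nra|].
  split; [split|].
  - left. positive_as (S + b * (1 - 2 * S ^ 2)). ring [HSC].
  - right; split; [subst b; field [HSC]; nra|right; split; [ring|]].
    positive_as (S * (3 - 4 * S ^ 2) / 2). subst b; field [HSC]; nra.
  - right; split; [ring|right; split; [ring|]].
    positive_as (C / 2). field.
Qed.

(** Strict already at the exact corners: Lower lies beyond w in the same cone of u. *)
Lemma far_terminal_avoids_lower (h S C b e : R) (F : angle_facts h S C b e) :
  lexblocks h h (true, Terminal) (false, Lower) (false, Terminal).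
Proof.
  destruct (cone_normals_right h) as [D1 D2].
  unfold lexblocks; unfold_lexpos F; rewrite D1, D2; unfold dir; substitute_values.
  assert (0 < b ^ 2) by nra.
  split; [split; left|split; [split; left; nra|left]].
  - assert (0 < (1 - 2 * S ^ 2)) by nra.
    assert (0 < b ^ 2 * (1 - 2 * S ^ 2)) by (apply Rmult_lt_0_compat; nra).
    assert (0 < b ^ 2 * (2 * S * C)) by (apply Rmult_lt_0_compat; nra).
    nra.
  - positive_as (S * (3 - 4 * S ^ 2) + b ^ 2 * S). ring [HSC].
  - positive_as (b ^ 2 * C). ring [HSC].
Qed.

(** Seen from Inner, Lower starts on a boundary ray and level with w. Its motion to the left repairs
    both at order [eta], an order at which Inner itself does not move. *)
Lemma inner_avoids_terminal (h S C b e : R) (F : angle_facts h S C b e) :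
  lexblocks h (- (PI / 2) + 2 * h) (false, Inner) (false, Terminal) (false, Lower).
Proof.
  assert (D1 : dir (- (PI / 2) + 2 * h - 2 * h + PI / 2) = (1, 0)).
  { rewrite dir_plus_PI2; replace (- (PI / 2) + 2 * h - 2 * h) with (- (PI / 2)) by ring.
    rewrite sin_neg, cos_neg, sin_PI2, cos_PI2; f_equal; ring. }
  assert (D2 : dir (- (PI / 2) + 2 * h + 2 * h - PI / 2) = (- cos (4 * h), - sin (4 * h))).
  { rewrite dir_minus_PI2.
    replace (- (PI / 2) + 2 * h + 2 * h) with (4 * h - PI / 2) by ring.
    rewrite sin_minus, cos_minus, sin_PI2, cos_PI2; f_equal; ring. }
  assert (D3 : dir (- (PI / 2) + 2 * h) = (sin (2 * h), - cos (2 * h))).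
  { replace (- (PI / 2) + 2 * h) with (2 * h - PI / 2) by ring; apply dir_minus_PI2. }
  unfold lexblocks; unfold_lexpos F; rewrite D1, D2, D3; substitute_values.
  split; [split; left|split; [split|]].
  - nra.
  - positive_as (b * (S * (3 - 4 * S ^ 2))). ring [HSC].
  - left. assert (0 < b ^ 2 * (1 - 2 * S ^ 2)) by (apply Rmult_lt_0_compat; nra).
    positive_as (b ^ 2 * (1 - 2 * S ^ 2) + b * S). ring.
  - right; split; [subst b; field [HSC]; nra|left].
    assert (S ^ 2 < 4 / 100) by nra. nra.
  - right; split; [ring|left]. nra.
Qed.

(** Seen from w, Upper starts on a boundary ray and at the height of Inner. The shift [(-1, -1)]
    lowers it, and also brings it into the cone because [sin (2 * h) < cos (2 * h)]. *)
Lemma terminal_avoids_inner (h S C b e : R) (F : angle_facts h S C b e) :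
  lexblocks h (PI / 2) (false, Terminal) (false, Inner) (false, Upper).
Proof.
  assert (D1 : dir (PI / 2 - 2 * h + PI / 2) = (- cos (2 * h), sin (2 * h))).
  { rewrite dir_plus_PI2, sin_minus, cos_minus, sin_PI2, cos_PI2; f_equal; ring. }
  assert (D2 : dir (PI / 2 + 2 * h - PI / 2) = (cos (2 * h), sin (2 * h))).
  { rewrite dir_minus_PI2, sin_plus, cos_plus, sin_PI2, cos_PI2; f_equal; ring. }
  assert (D3 : dir (PI / 2) = (0, 1)).
  { unfold dir; now rewrite sin_PI2, cos_PI2. }
  unfold lexblocks; unfold_lexpos F; rewrite D1, D2, D3; substitute_values.
  split; [split; left|split; [split|]].
  - positive_as (b * (S * (3 - 4 * S ^ 2))). ring [HSC].
  - positive_as (b * S). ring [HSC].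
  - right; split; [ring|left]. nra.
  - left. assert (0 < 2 * S * C * e) by (repeat apply Rmult_lt_0_compat; lra).
    positive_as (2 * (1 - 2 * S ^ 2) * (2 * S * C * e)). ring.
  - right; split; [subst e; field; nra|left; lra].
Qed.

Lemma cone_normals_left (h : R) :
  dir (PI - h - 2 * h + PI / 2) = (- sin (3 * h), - cos (3 * h)) /\
  dir (PI - h + 2 * h - PI / 2) = (- sin h, cos h).
Proof.
  split.
  - rewrite dir_plus_PI2; replace (PI - h - 2 * h) with (PI - 3 * h) by ring.
    rewrite sin_minus, cos_minus, sin_PI, cos_PI; f_equal; ring.
  - rewrite dir_minus_PI2; replace (PI - h + 2 * h) with (PI - - h) by ring.
    rewrite sin_minus, cos_minus, sin_PI, cos_PI, sin_neg, cos_neg; f_equal; ring.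
Qed.

(** The mirror image of Inner is the far corner of T_wu, hence level with u in the direction
    [PI - h]; only this comparison needs order [eta^2]. *)
Lemma lower_avoids_far_terminal (h S C b e : R) (F : angle_facts h S C b e) :
  lexblocks h (PI - h) (false, Lower) (true, Terminal) (true, Inner).
Proof.
  destruct (cone_normals_left h) as [D1 D2].
  unfold lexblocks; unfold_lexpos F; rewrite D1, D2, dir_PI_minus; substitute_values.
  assert (Hb2 : 0 < b ^ 2 < 1) by nra.
  assert (HS2 : 0 < S ^ 2 < 4 / 100) by nra.
  assert (HSS : 0 < S * (3 - 4 * S ^ 2)) by nra.
  (* The polynomial is [sin (5 * h)], from the boundary at angle [3 * h] and Lower at angle
     [2 * h]. *)
  assert (HS5 : 0 < S * (5 - 20 * S ^ 2 + 16 * S ^ 4)) by (apply Rmult_lt_0_compat; nra).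
  assert (Hb5 : 0 < b ^ 2 * (S * (5 - 20 * S ^ 2 + 16 * S ^ 4)))
    by (apply Rmult_lt_0_compat; lra).
  assert (HSb : 0 < S * (1 - b ^ 2)) by (apply Rmult_lt_0_compat; lra).
  split; [split; left|split; [split; left|]].
  - positive_as (S * (3 - 4 * S ^ 2) + b ^ 2 * (S * (5 - 20 * S ^ 2 + 16 * S ^ 4))).
    ring [HSC].
  - positive_as (S * (1 - b ^ 2)). ring [HSC].
  - positive_as (b ^ 2 * (S * (5 - 20 * S ^ 2 + 16 * S ^ 4))). subst b; field [HSC]; nra.
  - positive_as (b * (1 - 2 * S ^ 2) + S * (1 - b ^ 2)). ring [HSC].
  - right; split; [ring|right; split; [ring|]].
    positive_as (C / 2). field.
Qed.

Lemma lower_avoids_far_lower (h S C b e : R) (F : angle_facts h S C b e) :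
  lexblocks h (PI - h) (false, Lower) (true, Lower) (true, Terminal).
Proof.
  destruct (cone_normals_left h) as [D1 D2].
  unfold lexblocks; unfold_lexpos F; rewrite D1, D2, dir_PI_minus; substitute_values.
  assert (Hb2 : 0 < b ^ 2 < 1) by nra.
  assert (HS2 : 0 < S ^ 2 < 4 / 100) by nra.
  assert (HSS : 0 < S * (3 - 4 * S ^ 2)) by nra.
  assert (HS5 : 0 < S * (5 - 20 * S ^ 2 + 16 * S ^ 4)) by (apply Rmult_lt_0_compat; nra).
  assert (Hb5 : 0 < b ^ 2 * (S * (5 - 20 * S ^ 2 + 16 * S ^ 4)))
    by (apply Rmult_lt_0_compat; lra).
  assert (HSb : 0 < S * (1 - b ^ 2)) by (apply Rmult_lt_0_compat; lra).
  assert (0 < b ^ 2 * (1 - 2 * S ^ 2)) by (apply Rmult_lt_0_compat; nra).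
  split; [split; left|split; [split; left|left]].
  - nra.
  - nra.
  - positive_as (S * (3 - 4 * S ^ 2) + b ^ 2 * (S * (5 - 20 * S ^ 2 + 16 * S ^ 4))).
    ring [HSC].
  - positive_as (S * (1 - b ^ 2)). ring [HSC].
  - positive_as (b ^ 2 * C). ring [HSC].
Qed.

(** * The potential and the value of L *)

(** Lengths of shortest routes to w among the points on its side when the edge between w and Inner
    is blocked: Inner must pass through Upper or Lower, at the same cost. *)
Definition near_dist (h : R) (k : kind) : R :=
  match k with
  | Terminal => 0 | Inner => eh h + bh h ^ 2 | Upper => eh h | Lower => bh h ^ 2
  end.

Definition far_dist (h : R) : R := edist (0, 0) (corner h Upper).

(** Rises from 0 at u to L at w: the distance from u on the side of u, and L minus the distance to w
    on the side of w. *)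
Definition potential (h : R) (i : idx) : R :=
  if fst i then near_dist h (snd i) else far_dist h + eh h - near_dist h (snd i).

(** The radicand is [(2 D)^2] with [D = far_dist h], and the two tangent terms add up to [eh h]
    because [sin (3h) cos h = (sin (4h) + sin (2h)) / 2]. *)
Lemma lower_bound_L_eq (k : nat) (h : R) :
  cone_angle (4 * k + 5) = 4 * h -> 0 < h <= PI / 18 ->
  lower_bound_L k = far_dist h + eh h.
Proof.
  intros Hth Hh; unfold lower_bound_L; cbv zeta; rewrite Hth.
  replace (4 * h / 2) with (2 * h) by field.
  pose proof (angle_facts_exist h Hh) as F.
  set (S := sin h) in *; set (C := cos h) in *.
  set (D := far_dist h).
  assert (HD : D * D = (1 + eh h * sin (2 * h)) ^ 2 + (eh h * cos (2 * h)) ^ 2).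
  { unfold D, far_dist; rewrite edist_sq; unfold corner; cbn [fst snd]; ring. }
  assert (HD0 : 0 <= D) by apply edist_nonneg.
  set (b := bh h) in *; set (e := eh h) in *; clearbody S C D b e.
  destruct F as [HS HC HSC Hb He Es1 Ec1 Eb Ee Es2 Ec2 Es3 Ec3 Es4 Ec4 Hb0 He0].
  unfold tan; rewrite Ec2, Es2 in *.
  match goal with |- / 2 * sqrt ?X + _ + _ = _ => replace X with ((2 * D) * (2 * D)) end.
  - rewrite sqrt_square by lra; subst e b; field [HSC]; nra.
  - transitivity (4 * (D * D)); [ring|rewrite HD; subst e b; field [HSC]; nra].
Qed.

(* The pairs that are too close for the potential and must not be edges. *)
Definition missing (i j : idx) : bool :=
  match snd i, snd j with
  | Terminal, Terminal | Lower, Lower => xorb (fst i) (fst j)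
  | Terminal, Inner | Inner, Terminal => negb (xorb (fst i) (fst j))
  | Terminal, Lower | Lower, Terminal => xorb (fst i) (fst j)
  | _, _ => false
  end.

Lemma edist_mir (p q : pt) : edist (mir p) (mir q) = edist p q.
Proof.
  apply edist_eq; [apply edist_nonneg|].
  pose proof (edist_sq p q); unfold mir; cbn [fst snd].
  replace (edist p q ^ 2) with (edist p q * edist p q) by ring; rewrite H; ring.
Qed.

(** The short segments have exact lengths [e] and [b^2], and |u Upper| is [far_dist h]. The triangle
    inequality gives most other pairs; differences of abscissas handle Inner and Upper against their
    own mirror images. *)
Lemma potential_le (h S C b e : R) (F : angle_facts h S C b e) (i j : idx) :
  missing i j = false ->
  potential h j - potential h i <= edist (base h i) (base h j).
Proof.
  destruct F as [HS HC HSC Hb He Es1 Ec1 Eb Ee Es2 Ec2 Es3 Ec3 Es4 Ec4 Hb0 He0].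
  set (w := corner h Terminal); set (pA := corner h Inner);
  set (pB := corner h Upper); set (pC := corner h Lower).
  set (u := mir w).
  assert (Ew : w = (1, 0)) by reflexivity.
  assert (EA : pA = (1 - b * S, b * C)) by (unfold pA, corner; now rewrite Eb, Es1, Ec1).
  assert (EB : pB = (1 + e * (2 * S * C), e * (1 - 2 * S ^ 2)))
    by (unfold pB, corner; now rewrite Ee, Es2, Ec2).
  assert (EC : pC = (1 + b ^ 2 * (1 - 2 * S ^ 2), b ^ 2 * (2 * S * C)))
    by (unfold pC, corner; now rewrite Eb, Es2, Ec2).
  assert (Eu : u = (0, 0)) by (unfold u, mir; rewrite Ew; simpl; f_equal; ring).
  assert (HD : edist u pB = far_dist h) by now rewrite Eu.
  assert (dBw : edist pB w = e).
  { apply edist_eq; [lra|]; rewrite EB, Ew; cbn [fst snd]; ring [HSC]. }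
  assert (dCw : edist pC w = b ^ 2).
  { apply edist_eq; [nra|]; rewrite EC, Ew; cbn [fst snd]; ring [HSC]. }
  assert (dAB : edist pA pB = b ^ 2).
  { apply edist_eq; [nra|]; rewrite EA, EB; cbn [fst snd]; subst e b; field [HSC]; nra. }
  assert (dAC : edist pA pC = e).
  { apply edist_eq; [lra|]; rewrite EA, EC; cbn [fst snd]; subst e b; field [HSC]; nra. }
  assert (duw : edist u w = 1).
  { apply edist_eq; [lra|]; rewrite Eu, Ew; cbn [fst snd]; ring. }
  assert (D1 : 1 <= far_dist h).
  { rewrite <- HD, edist_sym; pose proof (edist_ge_fst pB u) as H.
    rewrite EB, Eu in H at 1; cbn [fst snd] in H.
    assert (0 < e * (2 * S * C)) by (repeat apply Rmult_lt_0_compat; lra). lra. }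
  assert (De : far_dist h <= 1 + e).
  { rewrite <- HD, <- duw, <- dBw; rewrite (edist_sym pB w); apply edist_triangle. }
  assert (dAA : edist pA (mir pA) >= 1 - 2 * b * S).
  { pose proof (edist_ge_fst pA (mir pA)) as H; rewrite EA in H at 1 2.
    unfold mir in H at 1; cbn [fst snd] in H; lra. }
  assert (dBB : edist pB (mir pB) >= 1).
  { pose proof (edist_ge_fst pB (mir pB)) as H; rewrite EB in H at 1 2.
    unfold mir in H at 1; cbn [fst snd] in H.
    assert (0 < e * (2 * S * C)) by (repeat apply Rmult_lt_0_compat; lra). lra. }
  assert (mBu : edist (mir pB) u = e) by (unfold u; now rewrite edist_mir).
  assert (mCu : edist (mir pC) u = b ^ 2) by (unfold u; now rewrite edist_mir).
  assert (uA : far_dist h - b ^ 2 <= edist pA u).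
  { pose proof (edist_triangle u pA pB) as H; rewrite (edist_sym u pA) in H; lra. }
  assert (dBC : edist pB pC >= e - b ^ 2).
  { pose proof (edist_triangle pB pC w); lra. }
  assert (dAmC : edist pA (mir pC) >= far_dist h - 2 * b ^ 2).
  { pose proof (edist_triangle pA (mir pC) u); lra. }
  assert (dAmB : edist pA (mir pB) >= far_dist h - b ^ 2 - e).
  { pose proof (edist_triangle pA (mir pB) u); lra. }
  assert (dBmC : edist pB (mir pC) >= far_dist h - b ^ 2).
  { pose proof (edist_triangle pB (mir pC) u) as H; rewrite (edist_sym pB u) in H; lra. }
  assert (b2 : 0 < b ^ 2 < 3 / 10) by nra.
  assert (b2e : b ^ 2 < e) by nra.
  (* Inner and its mirror image are at least [1 - 2 b S] apart and need [far_dist h - e - 2 b^2];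
     this bound and [De] suffice. *)
  assert (bS : 0 < b * S <= b ^ 2).
  { assert (S < b) by (assert (b * (1 - 2 * S ^ 2) = S * (3 - 4 * S ^ 2))
      by (subst b; field; nra); nra). nra. }
  (* By reflection it suffices to bound the absolute difference for one order
     of the two points and one choice of side. *)
  assert (same : forall k l, missing (false, k) (false, l) = false ->
    Rabs (near_dist h k - near_dist h l) <= edist (corner h k) (corner h l)).
  { assert (half : forall k l, Rabs (near_dist h k - near_dist h l) <= edist (corner h k) (corner h l) ->
      Rabs (near_dist h l - near_dist h k) <= edist (corner h l) (corner h k))
      by (intros k l; now rewrite Rabs_minus_sym, edist_sym).
    assert (refl : forall k, Rabs (near_dist h k - near_dist h k) <= edist (corner h k) (corner h k))
      by (intros k; rewrite Rminus_diag, Rabs_R0; apply edist_nonneg).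
    intros [| | |] [| | |] Hm; try discriminate Hm; try apply refl;
    try (apply half; fold w pA pB pC; apply Rabs_le; unfold near_dist; rewrite ?Eb, ?Ee; lra);
    fold w pA pB pC; apply Rabs_le; unfold near_dist; rewrite ?Eb, ?Ee; lra. }
  assert (opp : forall k l, missing (false, k) (true, l) = false ->
    Rabs (far_dist h + e - near_dist h k - near_dist h l) <= edist (corner h k) (mir (corner h l))).
  { assert (half : forall k l,
      Rabs (far_dist h + e - near_dist h k - near_dist h l) <= edist (corner h k) (mir (corner h l)) ->
      Rabs (far_dist h + e - near_dist h l - near_dist h k) <= edist (corner h l) (mir (corner h k))).
    { intros k l H.
      replace (far_dist h + e - near_dist h l - near_dist h k)
        with (far_dist h + e - near_dist h k - near_dist h l) by ring.
      rewrite edist_sym, <- edist_mir.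
      replace (mir (mir (corner h k))) with (corner h k); [exact H|].
      unfold mir; destruct (corner h k); simpl; f_equal; ring. }
    intros [| | |] [| | |] Hm; try discriminate Hm;
    try (fold w pA pB pC; fold u; apply Rabs_le; unfold near_dist; rewrite ?Eb, ?Ee;
         try rewrite (edist_sym pB u); lra);
    apply half; fold w pA pB pC; fold u; apply Rabs_le; unfold near_dist; rewrite ?Eb, ?Ee;
    try rewrite (edist_sym pB u); lra. }
  clear - same opp Ee.
  intros Hm; destruct i as [[|] k], j as [[|] l]; unfold potential, base; cbn [fst snd].
  - rewrite edist_mir; eapply Rle_trans; [|apply (same k l)].
    + rewrite Rabs_minus_sym; apply Rle_abs.
    + destruct k, l; exact Hm.
  - rewrite edist_sym; eapply Rle_trans; [|apply (opp l k)].
    + rewrite Ee; eapply Rle_trans; [|apply Rle_abs]; lra.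
    + destruct k, l; exact Hm.
  - eapply Rle_trans; [|apply (opp k l)].
    + rewrite Ee, <- Rabs_Ropp; eapply Rle_trans; [|apply Rle_abs]; lra.
    + destruct k, l; exact Hm.
  - eapply Rle_trans; [|apply (same k l)].
    + eapply Rle_trans; [|apply Rle_abs]; lra.
    + destruct k, l; exact Hm.
Qed.

(** * Available bisectors and blocked pairs *)

Definition is_bisector (m : nat) (b : R) : Prop :=
  exists n, (n < m)%nat /\ bisector m n = dir b.

(** The reflection fixes cone 0 and sends cone [n > 0] to cone [m - n], up to a full turn. *)
Lemma is_bisector_mir (m : nat) (b : R) :
  (5 <= m)%nat -> is_bisector m b -> is_bisector m (PI - b).
Proof.
  intros Hm [n [Hn E]]; destruct (cone_angle_bounds m Hm) as [_ Hc].
  assert (E' : (- cos b, sin b) = dir (PI - (PI / 2 - INR n * cone_angle m))).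
  { unfold bisector, dir in E; injection E as E1 E2.
    now rewrite dir_PI_minus, E1, E2. }
  unfold is_bisector; rewrite dir_PI_minus, E'.
  destruct n as [|n].
  - exists 0%nat; split; [lia|unfold bisector; f_equal; simpl; lra].
  - exists (m - S n)%nat; split; [lia|unfold bisector].
    rewrite minus_INR, Rmult_minus_distr_r, Hc by lia.
    replace (PI / 2 - (2 * PI - INR (S n) * cone_angle m))
      with (PI - (PI / 2 - INR (S n) * cone_angle m) - 2 * PI) by field.
    generalize (PI - (PI / 2 - INR (S n) * cone_angle m)); intros a.
    unfold dir; rewrite cos_minus, sin_minus, cos_2PI, sin_2PI; f_equal; ring.
Qed.

(** The residue of the number of cones modulo 4 enters here: [PI / 2 = (4k+5) h], so turning
    clockwise from the vertical by [k + 1] cones, each of angle [4 h], leaves exactly the angle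
    [h]. *)
Lemma bisectors_used (k : nat) (h : R) : (1 <= k)%nat ->
  cone_angle (4 * k + 5) = 4 * h ->
  is_bisector (4 * k + 5) h /\ is_bisector (4 * k + 5) (PI / 2) /\
  is_bisector (4 * k + 5) (- (PI / 2) + 2 * h).
Proof.
  intros Hk Hth.
  destruct (cone_angle_bounds (4 * k + 5) ltac:(lia)) as [_ E]; rewrite Hth in E.
  rewrite plus_INR, mult_INR in E; simpl in E.
  split; [exists (k + 1)%nat|split; [exists 0%nat|exists (2 * k + 2)%nat]];
  (split; [lia|unfold bisector; rewrite Hth; f_equal]).
  - rewrite plus_INR; simpl; lra.
  - simpl; ring.
  - rewrite plus_INR, mult_INR; simpl; lra.
Qed.

Definition blocked (m : nat) (h : R) (P : idx -> pt) (i j : idx) : Prop :=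
  exists z b, is_bisector m b /\ blocks (2 * h) b (P i) (P j) (P z).

Lemma swap_swap (i : idx) : swap (swap i) = i.
Proof. destruct i as [[|] ?]; reflexivity. Qed.

Lemma blocked_swap (m : nat) (h eta : R) (i j : idx) : (5 <= m)%nat ->
  blocked m h (cfg h eta) (swap i) (swap j) -> blocked m h (cfg h eta) i j.
Proof.
  intros Hm [z [b [Hb H]]]; exists (swap z), (PI - b); split; [now apply is_bisector_mir|].
  apply blocks_mir in H; now rewrite <- !cfg_swap, !swap_swap in H.
Qed.

(** The twelve ordered pairs reduce to six by reflection. Both orders are needed, since either
    endpoint may create an edge. *)
Lemma missing_blocked (k : nat) (h : R) (i j : idx) : (1 <= k)%nat ->
  cone_angle (4 * k + 5) = 4 * h -> 0 < h <= PI / 18 ->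
  missing i j = true -> eventually (fun eta => blocked (4 * k + 5) h (cfg h eta) i j).
Proof.
  intros Hk Hth Hh Hm.
  pose proof (angle_facts_exist h Hh) as F.
  destruct (bisectors_used k h Hk Hth) as [B1 [B2 B3]].
  pose proof (is_bisector_mir (4 * k + 5) h ltac:(lia) B1) as B4.
  assert (direct : forall z b i j, is_bisector (4 * k + 5) b -> lexblocks h b i j z ->
    eventually (fun eta => blocked (4 * k + 5) h (cfg h eta) i j)).
  { clear; intros z b i j Hb H; apply lexblocks_eventually in H.
    revert H; apply (filter_like_impl _ eventually_filter).
    intros eta H; now exists z, b. }
  assert (flipped : forall i j,
    eventually (fun eta => blocked (4 * k + 5) h (cfg h eta) (swap i) (swap j)) ->
    eventually (fun eta => blocked (4 * k + 5) h (cfg h eta) i j)).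
  { clear; intros i j; apply (filter_like_impl _ eventually_filter).
    intros eta; apply blocked_swap; lia. }
  pose proof (direct _ _ _ _ B1 (far_terminal_avoids_terminal _ _ _ _ _ F)) as L1.
  pose proof (direct _ _ _ _ B1 (far_terminal_avoids_lower _ _ _ _ _ F)) as L2.
  pose proof (direct _ _ _ _ B3 (inner_avoids_terminal _ _ _ _ _ F)) as L3.
  pose proof (direct _ _ _ _ B2 (terminal_avoids_inner _ _ _ _ _ F)) as L4.
  pose proof (direct _ _ _ _ B4 (lower_avoids_far_terminal _ _ _ _ _ F)) as L5.
  pose proof (direct _ _ _ _ B4 (lower_avoids_far_lower _ _ _ _ _ F)) as L6.
  destruct i as [[|] [| | |]], j as [[|] [| | |]]; try discriminate Hm;
  first [assumption|apply flipped; assumption].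
Qed.

(** * Open conditions *)

Definition around (T : idx -> pt) (Q : (idx -> pt) -> Prop) : Prop :=
  exists d, 0 < d /\ forall P, (forall i, near d (T i) (P i)) -> Q P.

Lemma around_filter (T : idx -> pt) : filter_like (around T).
Proof.
  split.
  - exists 1; split; [lra|auto].
  - intros S S' [e [He H]] [e' [He' H']]; exists (Rmin e e').
    split; [now apply Rmin_glb_lt|].
    intros P HP; split; [apply H|apply H']; intros i; (eapply near_le; [|apply HP]);
    [apply Rmin_l|apply Rmin_r].
  - intros S S' HS [e [He H]]; exists e; split; auto.
Qed.

Lemma around_gap (T : idx -> pt) (a : R) (i j : idx) :
  0 < gap a (T i) (T j) -> around T (fun P => 0 < gap a (P i) (P j)).
Proof.
  (* If both points move by less than [d] in each coordinate, each coordinate contributes less than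
     [2 d] to the change of the gap. *)
  intros H; exists (gap a (T i) (T j) / 4); split; [lra|intros P HP].
  set (d := gap a (T i) (T j) / 4) in *.
  destruct (HP i) as [H1 H2], (HP j) as [H3 H4].
  assert (E : gap a (T i) (T j) = 4 * d) by (unfold d; field).
  assert (main : gap a (T i) (T j) - gap a (P i) (P j) < 4 * d).
  2: lra.
  assert (Hd : 0 < d) by lra.
  clearbody d; clear H E HP.
  replace (gap a (T i) (T j) - gap a (P i) (P j)) with
    (((fst (T j) - fst (P j)) - (fst (T i) - fst (P i))) * cos a +
     ((snd (T j) - snd (P j)) - (snd (T i) - snd (P i))) * sin a)
    by (unfold gap, dot, vsub, dir; simpl; ring).
  assert (aux : forall x y c, Rabs x < d -> Rabs y < d -> -1 <= c <= 1 -> (x - y) * c < 2 * d).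
  { clear - Hd; intros x y c Hx Hy Hc; apply Rabs_def2 in Hx, Hy.
    assert (Rabs (x - y) < 2 * d) by (apply Rabs_def1; lra).
    assert (Rabs c <= 1) by (apply Rabs_le; lra).
    pose proof (Rle_abs ((x - y) * c)) as Hxy; rewrite Rabs_mult in Hxy.
    pose proof (Rabs_pos (x - y)); nra. }
  pose proof (aux _ _ _ H3 H1 (COS_bound a)).
  pose proof (aux _ _ _ H4 H2 (SIN_bound a)); lra.
Qed.

Lemma around_blocked (m : nat) (h : R) (T : idx -> pt) (i j : idx) :
  blocked m h T i j -> around T (fun P => blocked m h P i j).
Proof.
  intros [z [b [Hb [[H1 H2] [[H3 H4] H5]]]]].
  apply (filter_like_impl _ (around_filter T)) with (fun P => blocks (2 * h) b (P i) (P j) (P z)).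
  - intros P HP; now exists z, b.
  - repeat apply (filter_like_and _ (around_filter T)); now apply around_gap.
Qed.

Lemma near_edist (d : R) (p q : pt) : near d p q -> edist p q <= 2 * d.
Proof.
  intros [H1 H2]; pose proof (edist_sq p q); pose proof (edist_nonneg p q).
  apply Rabs_def2 in H1, H2.
  apply Rsqr_incr_0_var; unfold Rsqr; nra.
Qed.

Lemma around_edist (T : idx -> pt) (i j : idx) (r : R) : 0 < r ->
  around T (fun P => Rabs (edist (P i) (P j) - edist (T i) (T j)) < r).
Proof.
  intros Hr; exists (r / 8); split; [lra|intros P HP].
  pose proof (near_edist _ _ _ (HP i)); pose proof (near_edist _ _ _ (HP j)).
  pose proof (edist_triangle (T i) (P i) (T j)); pose proof (edist_triangle (P i) (P j) (T j)).
  pose proof (edist_triangle (P i) (T i) (P j)); pose proof (edist_triangle (T i) (T j) (P j)).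
  rewrite (edist_sym (P j) (T j)), (edist_sym (P i) (T i)) in *.
  apply Rabs_def1; lra.
Qed.

(** [potential_le] is tight on some pairs, so it is not stable by itself. For a positive difference
    [t] the factor [1 - r] leaves room [r * t]; otherwise the bound is trivial. *)
Lemma around_potential (h r : R) (i j : idx) : 0 < h <= PI / 18 -> 0 < r < 1 ->
  missing i j = false ->
  around (base h) (fun P => (1 - r) * (potential h j - potential h i) <= edist (P i) (P j)).
Proof.
  intros Hh Hr Hm.
  pose proof (potential_le _ _ _ _ _ (angle_facts_exist h Hh) i j Hm) as Hle.
  set (t := potential h j - potential h i) in *.
  destruct (Rle_dec t 0) as [Ht|Ht].
  - apply (filter_like_impl _ (around_filter _)) with (2 := filter_like_true _ (around_filter _)).
    intros P _; pose proof (edist_nonneg (P i) (P j)); nra.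
  - apply (filter_like_impl _ (around_filter _)) with
      (2 := around_edist (base h) i j (r * t) ltac:(apply Rmult_lt_0_compat; lra)).
    intros P HP; apply Rabs_def2 in HP; lra.
Qed.

(** * Walks and the choice of parameters *)

(** The potential differences telescope along the walk. Distinctness of the points identifies the
    index at its end with [w]. *)
Lemma walk_len_potential (A : Type) (l : list A) (P : A -> pt) (adj : pt -> pt -> Prop)
    (f : A -> R) (w : A) :
  NoDup (map P l) -> In w l ->
  (forall i x, In i l -> adj (P i) x -> exists j, In j l /\ x = P j) ->
  (forall i j, In i l -> In j l -> adj (P i) (P j) -> f j - f i <= edist (P i) (P j)) ->
  forall path i, In i l -> walk adj (P i) path (P w) -> f w - f i <= walk_len (P i) path.
Proof.
  intros Hnd Hw Hin Hadj path; induction path as [|x path IH]; intros i Hi Hwalk; simpl in *.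
  - assert (i = w); [|subst; lra].
    destruct (In_nth _ _ w Hi) as [a [Ha Ea]], (In_nth _ _ w Hw) as [c [Hc Ec]].
    rewrite (NoDup_nth _ (P w)), length_map in Hnd.
    assert (a = c) by (apply Hnd; try assumption; now rewrite !map_nth, Ea, Ec).
    congruence.
  - destruct Hwalk as [H1 H2]; destruct (Hin i x Hi H1) as [j [Hj ->]].
    pose proof (IH j Hj H2); pose proof (Hadj i j Hi Hj H1); lra.
Qed.

Lemma missing_sym (i j : idx) : missing i j = missing j i.
Proof. destruct i as [[|] [| | |]], j as [[|] [| | |]]; reflexivity. Qed.

Theorem mainTheorem17 :
  forall (k : nat), (1 <= k)%nat ->
  forall eps : R, eps > 0 ->
  exists (P : list pt) (u w : pt),
    NoDup P /\ gen_pos (4 * k + 5) P /\ In u P /\ In w P /\ u <> w /\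
    forall l : list pt, walk (theta_adj (4 * k + 5) P) u l w ->
      walk_len u l >= (lower_bound_L k - eps) * edist u w.
Proof.
  intros k Hk eps Heps.
  set (m := (4 * k + 5)%nat).
  assert (Hm : (5 <= m)%nat) by (unfold m; lia).
  set (h := cone_angle m / 4).
  assert (Hth : cone_angle m = 4 * h) by (unfold h; field).
  assert (Hh : 0 < h <= PI / 18).
  { destruct (cone_angle_bounds m Hm) as [Hc E]; split; [unfold h; lra|].
    assert (9 <= INR m) by (replace 9 with (INR 9) by (simpl; ring); apply le_INR; unfold m; lia).
    rewrite Hth in *; nra. }
  rewrite (lower_bound_L_eq k h Hth Hh).
  set (L := far_dist h + eh h).
  assert (HL : 0 < L).
  { pose proof (af_e0 _ _ _ _ _ (angle_facts_exist h Hh)).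
    pose proof (af_b0 _ _ _ _ _ (angle_facts_exist h Hh)).
    pose proof (edist_nonneg (0, 0) (corner h Upper)).
    unfold L, far_dist; lra. }
  (* Truncating at L keeps [L - eps0] nonnegative and makes [r < 1] below. *)
  set (eps0 := Rmin eps L).
  assert (Heps0 : 0 < eps0) by (apply Rmin_glb_lt; lra).
  assert (Heps1 : eps0 <= eps) by apply Rmin_l.
  assert (Heps2 : eps0 <= L) by apply Rmin_r.
  clearbody eps0.
  (* Potentials lose a factor [1 - r] and |uw| is below [1 + r]; this choice gives [(L - eps0) (1 +
     r) <= L - eps0 / 2 = (1 - r) L]. *)
  set (r := eps0 / (2 * L)).
  assert (HrL : r * L = eps0 / 2) by (unfold r; field; lra).
  assert (Hr : 0 < r < 1) by nra.
  pose (iu := (true, Terminal) : idx); pose (iw := (false, Terminal) : idx).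
  (* The order of choices matters: first [d] around the exact corners for the lengths, then [eta]
     with [cfg] within [d / 2] and blocking strict, then a general-position perturbation within
     [d / 2] that keeps the blocking. *)
  assert (metric : around (base h) (fun P =>
    (forall i, In i all_idx -> forall j, In j all_idx -> missing i j = false ->
       (1 - r) * (potential h j - potential h i) <= edist (P i) (P j)) /\
    Rabs (edist (P iu) (P iw) - edist (base h iu) (base h iw)) < r)).
  { apply (filter_like_and _ (around_filter _)); [|now apply around_edist].
    apply (filter_like_list _ _ _ (around_filter _)); intros i _.
    apply (filter_like_list _ _ _ (around_filter _)); intros j _.
    destruct (missing i j) eqn:E.
    - apply (filter_like_impl _ (around_filter _)) with (2 := filter_like_true _ (around_filter _)).
      intros P _ Habs; discriminate Habs.
    - apply (filter_like_impl _ (around_filter _)) with (2 := around_potential h r i j Hh Hr E).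
      auto. }
  destruct metric as [d [Hd metric]].
  assert (conf : eventually (fun eta =>
    (forall i, In i all_idx -> near (d / 2) (base h i) (cfg h eta i)) /\
    (forall i, In i all_idx -> forall j, In j all_idx -> missing i j = true ->
       blocked m h (cfg h eta) i j))).
  { apply (filter_like_and _ eventually_filter); [apply cfg_near; lra|].
    apply (filter_like_list _ _ _ eventually_filter); intros i _.
    apply (filter_like_list _ _ _ eventually_filter); intros j _.
    destruct (missing i j) eqn:E.
    - apply (filter_like_impl _ eventually_filter) with (2 := missing_blocked k h i j Hk Hth Hh E).
      auto.
    - apply (filter_like_impl _ eventually_filter) with (2 := filter_like_true _ eventually_filter).
      intros eta _ Habs; discriminate Habs. }
  destruct conf as [e [He conf]].
  destruct (conf (e / 2) ltac:(lra)) as [Hnear Hblocked].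
  set (T := cfg h (e / 2)) in *.
  assert (open : around T (fun P => forall i, In i all_idx -> forall j, In j all_idx ->
    missing i j = true -> blocked m h P i j)).
  { apply (filter_like_list _ _ _ (around_filter _)); intros i Hi.
    apply (filter_like_list _ _ _ (around_filter _)); intros j Hj.
    destruct (missing i j) eqn:E.
    - apply (filter_like_impl _ (around_filter _)) with
        (2 := around_blocked m h T i j (Hblocked i Hi j Hj E)); auto.
    - apply (filter_like_impl _ (around_filter _)) with (2 := filter_like_true _ (around_filter _)).
      intros P _ Habs; discriminate Habs. }
  destruct open as [d2 [Hd2 open]].
  destruct (gen_pos_perturb idx idx_dec m all_idx T (Rmin (d / 2) d2)
    ltac:(apply Rmin_glb_lt; lra) nodup_all_idx) as [P [HP [Hnd Hgp]]].
  destruct (metric P) as [Hpot Huw].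
  { intros i; replace d with (d / 2 + d / 2) by field; eapply near_trans;
    [apply Hnear, in_all_idx|eapply near_le; [apply Rmin_l|apply HP]]. }
  assert (Hbl := open P ltac:(intros i; eapply near_le; [apply Rmin_r|apply HP])).
  clear metric conf open Hnear Hblocked HP.
  exists (map P all_idx), (P iu), (P iw).
  assert (Hiu : In iu all_idx) by apply in_all_idx.
  assert (Hiw : In iw all_idx) by apply in_all_idx.
  assert (E1 : edist (base h iu) (base h iw) = 1).
  { apply edist_eq; [lra|]; simpl; ring. }
  rewrite E1 in Huw; apply Rabs_def2 in Huw.
  split; [exact Hnd|split; [exact Hgp|]].
  split; [now apply in_map|split; [now apply in_map|split]].
  { intros E; rewrite E in Huw; rewrite (edist_eq (P iw) (P iw) 0) in Huw; [lra|lra|ring]. }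
  intros l Hwalk.
  assert (Hno : forall i j, missing i j = true -> ~ theta_edge m (map P all_idx) (P i) (P j)).
  { intros i j Hij; destruct (Hbl i (in_all_idx i) j (in_all_idx j) Hij) as [z [b [[n [Hn Hb]] Hz]]].
    apply (blocks_no_edge m n b _ _ _ (P z)); try assumption.
    - apply in_map, in_all_idx.
    - rewrite Hth; replace (4 * h / 2) with (2 * h) by field; exact Hz. }
  pose proof (walk_len_potential idx all_idx P (theta_adj m (map P all_idx))
    (fun i => (1 - r) * potential h i) iw Hnd Hiw) as Hlen.
  assert (Hlow : (1 - r) * potential h iw - (1 - r) * potential h iu <= walk_len (P iu) l).
  { apply Hlen; [| |exact Hiu|exact Hwalk].
    - intros i x _ [[_ [Hx _]]|[Hx _]]; apply in_map_iff in Hx;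
      destruct Hx as [j [Ej Hj]]; exists j; auto.
    - intros i j Hi Hj [Hedge|Hedge]; destruct (missing i j) eqn:E.
      + now apply Hno in Hedge.
      + pose proof (Hpot i Hi j Hj E); lra.
      + rewrite missing_sym in E; now apply Hno in Hedge.
      + pose proof (Hpot i Hi j Hj E); lra. }
  replace (potential h iw) with L in Hlow by (unfold potential, L; simpl; ring).
  replace (potential h iu) with 0 in Hlow by reflexivity.
  pose proof (edist_nonneg (P iu) (P iw)).
  assert ((L - eps) * edist (P iu) (P iw) <= (L - eps0) * edist (P iu) (P iw)) by nra.
  assert ((L - eps0) * edist (P iu) (P iw) <= (L - eps0) * (1 + r)) by nra.
  nra.
Qed.
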